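(* Let $\Gamma=(V,E)$ be a finite connected simple graph with $|V|=r+1\ge 3$ and $|E|=n\ge 3$. Then the Kirchhoff polynomial $F_\Gamma(\boldsymbol{x})$ is strictly homogeneous log-concave on $(\mathbb{R}_{>0})^n$; in other words, $$\left.\left(-F_\Gamma H_{F_\Gamma}+s(\nabla F_\Gamma)^T\nabla F_\Gamma\right)\right|_{\boldsymbol{x}=\boldsymbol{a}}\succ 0$$ for every $\boldsymbol{a}\in(\mathbb{R}_{>0})^n$ and every real $s>\frac{r-1}{r}$. In particular, $H_{F_\Gamma}|_{\boldsymbol{x}=\boldsymbol{a}}$ is non-degenerate, with $n-1$ negative eigenvalues and exactly one positive eigenvalue, and thus $(-1)^{n-1}(\det H_{F_\Gamma})|_{\boldsymbol{x}=\boldsymbol{a}}>0$. Moreover, for each spanning tree $T$ in $\Gamma$, $F_\Gamma$ is strictly homogeneous log-concave on $$C^n_{T>0}=\{\boldsymbol{z}\in\mathbb{R}^n_{\ge 0} : z_i>0\ (i\in T),\ z_j\ge 0\ (j\notin T)\}\ \supseteq(\mathbb{R}_{>0})^n .$$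
   Context: For a finite connected graph $\Gamma=(V,E)$ with edges labelled $1,\dots,n$, the Kirchhoff polynomial is $F_\Gamma(x_1,\dots,x_n)=\sum_{T}\prod_{i\in T}x_i$, the sum over all spanning trees $T$ of $\Gamma$ (identified with their edge sets); it is homogeneous of degree $r=|V|-1$. For a polynomial $F$, $H_F$ is the Hessian matrix and $\nabla F$ is the gradient as a row vector. $A\succ0$ means that the real symmetric matrix $A$ is positive definite. A homogeneous real polynomial $F$ of degree $r$ is strictly homogeneous log-concave at $\boldsymbol{a}\in\mathbb{R}^n$ if $(-FH_F+s(\nabla F)^T\nabla F)|_{\boldsymbol{x}=\boldsymbol{a}}\succ0$ for every real $s>\frac{r-1}{r}$; it is so on a set if it is so at every point of the set. *)

(* Defs.v *)
From mathcomp Require Import all_boot all_order all_algebra.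
From mathcomp Require Import boolp classical_sets reals.
From mathcomp Require Import mpoly.

Set Implicit Arguments.
Unset Strict Implicit.
Unset Printing Implicit Defensive.

Import Order.TTheory GRing.Theory Num.Theory.

Local Open Scope classical_set_scope.
Local Open Scope ring_scope.

(* A finite simple graph with n edges, labelled by 'I_n: simplicity means that
   every edge is a set of two distinct vertices and that distinct labels carry
   distinct edges. *)
Record sgraph (n : nat) := SGraph {
  vertex :> finType;
  edge : 'I_n -> {set vertex};
  edge_card : forall i, #|edge i| = 2%N;
  edge_inj : injective edge
}.

Section Graph.
Variables (n : nat) (G : sgraph n).
Implicit Type S : {set 'I_n}.

(* Adjacency in the spanning subgraph (V, S): all the vertices, and only the
   edges with label in S. *)
Definition adj S : rel G :=
  fun x y => [exists i in S, edge G i == [set x; y]%SET].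

Definition connected_edges S : Prop := forall x y : G, connect (adj S) x y.

(* A cycle is a closed walk through at least three distinct vertices. *)
Definition acyclic_edges S : Prop :=
  forall c : seq G, (2 < size c)%N -> ~~ ucycleb (adj S) c.

Definition spanning_tree S : Prop := connected_edges S /\ acyclic_edges S.

Definition connected_graph : Prop := connected_edges [set: 'I_n]%SET.

Definition kirchhoff (R : realType) : {mpoly R[n]} :=
  \sum_(T : {set 'I_n} | `[< spanning_tree T >]) \prod_(i in T) 'X_i.

End Graph.

Section LogConcavity.
Variables (R : realType) (n : nat).
Implicit Types (F : {mpoly R[n]}) (a : 'I_n -> R) (A : 'M[R]_n).

Definition hessian F : 'M[{mpoly R[n]}]_n := \matrix_(i, j) F^`M(i)^`M(j).

Definition gradient F : 'rV[{mpoly R[n]}]_n := \row_i F^`M(i).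

Definition evalmx a (M : 'M[{mpoly R[n]}]_n) : 'M[R]_n := map_mx (meval a) M.

Definition posdefmx A : Prop :=
  A^T = A /\ forall v : 'rV[R]_n, v != 0 -> 0 < (v *m A *m v^T) 0 0.

Definition strictly_hlc_at (r : nat) F a : Prop :=
  F \is r.-homog /\
  forall s : R, (r%:R - 1) / r%:R < s ->
    posdefmx (evalmx a (- (F *: hessian F)
                        + s%:MP *: ((gradient F)^T *m gradient F))).

Definition strictly_hlc_on (r : nat) F (D : set ('I_n -> R)) : Prop :=
  forall a, D a -> strictly_hlc_at r F a.

Definition positive_orthant : set ('I_n -> R) :=
  [set a | forall i, 0 < a i].

Definition tree_cone (T : {set 'I_n}) : set ('I_n -> R) :=
  [set z | (forall i, i \in T -> 0 < z i) /\ (forall j, j \notin T -> 0 <= z j)].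

(* The eigenvalues of A, listed with multiplicity, are exactly s; such an s is
   unique up to permutation. *)
Definition eigenvalues A (s : seq R) : Prop :=
  char_poly A = \prod_(x <- s) ('X - x%:P).

End LogConcavity.

(* Main.v *)
Require Import Defs.
From mathcomp Require Import all_boot all_order all_algebra.
From mathcomp Require Import boolp classical_sets reals.
From mathcomp Require Import mpoly.
From mathcomp Require Import perm sesquilinear spectral complex.
From mathcomp Require Import ring lra.

(** Orient the edges, delete one vertex, and let B be the resulting reduced
    incidence matrix, of size r x n. Write D(v) for the diagonal matrix of v and
    L(a) = B D(a) B^T for the weighted reduced Laplacian. The matrix-tree theorem
    ([matrix_tree]) says F(a) = det L(a); on the cone of a spanning tree T this is
    positive, since the term of T is positive and all the others are nonnegative.

    Put Q = B^T L(a)^-1 B. Raising a weight by 1 is a rank-one update of L(a), so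
    the determinant of the update gives F_e = F Q_ee and
    F_ef = F (Q_ee Q_ff - Q_ef^2) ([gradient_eval], [hessian_eval]). Hence, with
    K = (Q_ef^2) and g = (Q_ee),
      - F H + s grad^T grad = F^2 (K + (s - 1) g^T g)   and   H = F (g^T g - K).

    From Q D(a) Q = Q and tr (Q D(a)) = r one gets a K = g and g a^T = r. The
    matrix K is positive definite ([hadamard_sq_gt0]): with M = Q D(v) Q,
    v K v^T is the sum of the a_k a_l M_kl^2, and M = 0 forces B D(v) B^T = 0,
    hence v = 0 because in a simple graph no two edges share both ends
    ([gram_incidence_inj]). The Cauchy-Schwarz inequality for K between v and a
    reads (g v^T)^2 <= r (v K v^T), so K + (s - 1) g^T g is positive definite as
    soon as 1 - s < 1 / r, which is the bound s > (r - 1) / r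
    ([quadform_rank_one_gt0]).

    The Hessian is negative definite on the hyperplane g v^T = 0, while
    a H a^T = F (r^2 - r) > 0. Diagonalising it over the complex numbers, two
    eigenvalues >= 0 would produce a plane meeting that hyperplane in a vector on
    which the form is >= 0. So exactly one eigenvalue is positive and all the
    others are negative ([eigenvalue_signs]). *)

Set Implicit Arguments.
Unset Strict Implicit.
Unset Printing Implicit Defensive.

Import Order.TTheory GRing.Theory Num.Theory.

Local Open Scope ring_scope.

(** * Determinants of Gram matrices *)
Section Determinants.
Variable R : comNzRingType.

(** The block matrix with rows (1, - U) and (V, 1) has both sides as its determinant:
    multiply it by a unipotent block matrix on the right, or on the left. *)
Lemma det_1D_mulmx m k (U : 'M[R]_(m, k)) (V : 'M[R]_(k, m)) :
  \det (1%:M + U *m V) = \det (1%:M + V *m U).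
Proof.
have E1 : block_mx 1%:M (- U) V 1%:M *m block_mx 1%:M U 0 1%:M
   = block_mx 1%:M 0 V (1%:M + V *m U).
  rewrite mulmx_block !mulmx1 !mul1mx !mulmx0 !addr0 subrr.
  by congr block_mx; rewrite addrC.
have E2 : block_mx 1%:M U 0 1%:M *m block_mx 1%:M (- U) V 1%:M
   = block_mx (1%:M + U *m V) 0 V 1%:M.
  by rewrite mulmx_block !mulmx1 !mul1mx !mul0mx !add0r addNr.
have := congr1 determinant E1; have := congr1 determinant E2.
by rewrite !det_mulmx mulrC => -> ; rewrite !det_lblock !det1 mulr1 mul1r.
Qed.

Lemma det_mx22 (M : 'M[R]_2) : \det M = M 0 0 * M 1 1 - M 0 1 * M 1 0.
Proof.
rewrite (expand_det_row _ 0) !big_ord_recl big_ord0 addr0 /cofactor !det_mx11.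
rewrite !mxE /=.
have -> : lift 0 0 = 1 :> 'I_2 by apply: val_inj.
have -> : lift 1 0 = 0 :> 'I_2 by apply: val_inj.
by rewrite expr0 expr1 mul1r mulN1r mulrN.
Qed.

Definition gram r n (B : 'M[R]_(r, n)) (a : 'I_n -> R) : 'M[R]_r :=
  B *m diag_mx (\row_i a i) *m B^T.

Lemma gramE r n (B : 'M[R]_(r, n)) a i j :
  gram B a i j = \sum_e a e * B i e * B j e.
Proof.
rewrite /gram mxE; apply: eq_bigr => e _.
by rewrite mul_mx_diag !mxE [B i e * _]mulrC.
Qed.

Lemma tr_gram r n (B : 'M[R]_(r, n)) a : (gram B a)^T = gram B a.
Proof. by rewrite /gram !trmx_mul trmxK tr_diag_mx mulmxA. Qed.

(** A Cauchy-Binet formula whose coefficients are left as determinants. Expanding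
    along all columns gives a sum over maps f from rows to columns, where only the
    injective ones survive; grouped by the image S of f, the weights a enter only
    through their product over S. The coefficient of that product is then read off
    at the indicator function of S, where every other term vanishes. *)
Lemma det_gram r n (B : 'M[R]_(r, n)) (a : 'I_n -> R) :
  \det (gram B a) = \sum_(S : {set 'I_n} | #|S| == r)
     \det (gram B (fun i => (i \in S)%:R)) * \prod_(i in S) a i.
Proof.
pose w (f : {ffun 'I_r -> 'I_n}) := (\prod_i B i (f i)) * \det (colsub f B).
have expand b : \det (gram B b) = \sum_(f : {ffun 'I_r -> 'I_n} | injectiveb f)
    w f * \prod_i b (f i).
  rewrite -det_tr tr_gram.
  transitivity (\sum_(s : 'S_r) \sum_(f : {ffun 'I_r -> 'I_n})
      (-1) ^+ s * \prod_i (b (f i) * B i (f i) * B (s i) (f i))).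
    apply: eq_bigr => s _; rewrite -big_distrr /=; congr (_ * _).
    rewrite -(bigA_distr_bigA (fun i e => b e * B i e * B (s i) e)) /=; apply: eq_bigr => i _; exact: gramE.
  rewrite exchange_big /= [RHS]big_mkcond /=; apply: eq_bigr => f _.
  have -> : \sum_(s : 'S_r) (-1) ^+ s * \prod_i (b (f i) * B i (f i) * B (s i) (f i))
     = w f * \prod_i b (f i).
    rewrite /w -det_tr /determinant big_distrr big_distrl /=.
    apply: eq_bigr => s _; rewrite !big_split /=.
    under [\prod_i (colsub f B)^T _ _]eq_bigr do rewrite !mxE.
    by rewrite mulrCA -!mulrA mulrCA; congr (_ * _); rewrite mulrCA; congr (_ * _); exact: mulrC.
  case: ifPn => // /injectivePn[i [j ij fij]].
  rewrite /w -det_tr (determinant_alternate ij) ?mulr0 ?mul0r // => k.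
  by rewrite !mxE fij.
pose im (f : {ffun 'I_r -> 'I_n}) := [set f i | i in 'I_r].
have card_im (f : {ffun 'I_r -> 'I_n}) : injectiveb f -> #|im f| == r.
  by move=> /injectiveP fI; rewrite card_imset // card_ord.
have prod_im (f : {ffun 'I_r -> 'I_n}) b : injectiveb f -> \prod_(i in im f) b i = \prod_i b (f i) :> R.
  move=> /injectiveP fI; rewrite big_imset /=; last by move=> ? ? _ _; apply: fI.
  by apply: eq_bigl.
rewrite expand (partition_big im (fun S : {set 'I_n} => #|S| == r)) //.
apply: eq_bigr => S /eqP Sr; rewrite expand.
rewrite big_distrl /= [RHS](bigID (fun f => im f == S)) /=.
rewrite [X in _ + X]big1 ?addr0; last first.
  move=> f /andP[fI /eqP fS].
  rewrite -(prod_im f (fun e => (e \in S)%:R)) //.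
  have [i /andP[iIm iS]] : exists i, (i \in im f) && (i \notin S).
    apply/existsP; apply: contraT; rewrite negb_exists => /forallP H.
    case: fS; apply/eqP; rewrite eqEcard Sr (eqP (card_im _ fI)) leqnn andbT.
    by apply/fintype.subsetP => i iI; have := H i; rewrite iI negbK.
  by rewrite (bigD1 i) //= (negbTE iS) mul0r mulr0 mul0r.
apply: eq_bigr => f /andP[fI /eqP fS]; rewrite -prod_im //.
rewrite -(prod_im f (fun e => (e \in S)%:R)) // fS.
by rewrite [X in _ = _ * X * _]big1 ?mulr1 // => i ->.
Qed.

End Determinants.

(** * Derivatives of square-free polynomials *)
Section MultiAffine.
Variables (R : comNzRingType) (n : nat).
Implicit Types (S : {set 'I_n}) (a : 'I_n -> R).

Definition sqfree S : {mpoly R[n]} := \prod_(i in S) 'X_i.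

Definition shift a e : 'I_n -> R := fun i => a i + (i == e)%:R.

Lemma sqfree_eval S a : (sqfree S).@[a] = \prod_(i in S) a i.
Proof. by rewrite rmorph_prod /=; apply: eq_bigr => i _; rewrite mevalXU. Qed.

Lemma mderiv_sqfree S e :
  (sqfree S)^`M(e) = if e \in S then sqfree (S :\ e) else 0.
Proof.
have D0 (A : {set 'I_n}) : e \notin A -> (sqfree A)^`M(e) = 0.
  move=> eA; rewrite /sqfree; apply: (big_rec (fun p : {mpoly R[n]} => p^`M(e) = 0)).
    by rewrite -mpolyC1 mderivC.
  move=> i p iA pe; rewrite mderivM pe mulr0 addr0 mderivX mnm1E.
  have -> : (i == e) = false by apply: contraNF eA => /eqP <-.
  by rewrite scale0r mul0r.
case: ifPn => [eS|]; last exact: D0.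
rewrite [in LHS]/sqfree (bigD1 e) //= mderivM.
have -> : \prod_(i in S | i != e) 'X_i = sqfree (S :\ e) :> {mpoly R[n]}.
  by apply: eq_bigl => i; rewrite !inE andbC.
rewrite (D0 (S :\ e)); last by rewrite !inE eqxx.
by rewrite mulr0 addr0 mderivX mnm1E eqxx scale1r -{1}[U_(e)%MM]add0m addmK mpolyX0 mul1r.
Qed.

(** A square-free monomial is affine in each variable, so its partial derivative is
    a difference quotient with step 1. This turns derivatives of the Kirchhoff
    polynomial into values of a determinant. *)
Lemma mderiv_sqfree_shift S e a :
  (sqfree S)^`M(e).@[a] = (sqfree S).@[shift a e] - (sqfree S).@[a].
Proof.
rewrite mderiv_sqfree !sqfree_eval; case: ifPn => eS; last first.
  rewrite meval0 [X in X - _](eq_bigr a) ?subrr // => i iS.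
  by rewrite /shift; case: eqP iS eS => [->->//|]; rewrite addr0.
rewrite sqfree_eval !(bigD1 (R:=R) e eS) /=.
have E : \prod_(i in S | i != e) shift a e i = \prod_(i in S | i != e) a i.
  by apply: eq_bigr => i /andP[_ /negbTE ie]; rewrite /shift ie addr0.
rewrite E {1}/shift eqxx mulrDl addrAC subrr add0r mul1r.
by apply: eq_bigl => i; rewrite !inE andbC.
Qed.

Variable P : pred {set 'I_n}.
Let F : {mpoly R[n]} := \sum_(S | P S) sqfree S.

Lemma meval_big (f : {set 'I_n} -> {mpoly R[n]}) a :
  (\sum_(S | P S) f S).@[a] = \sum_(S | P S) (f S).@[a].
Proof. exact: raddf_sum. Qed.

Lemma mderiv_big (f : {set 'I_n} -> {mpoly R[n]}) e :
  (\sum_(S | P S) f S)^`M(e) = \sum_(S | P S) (f S)^`M(e).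
Proof. exact: raddf_sum. Qed.

Lemma mderiv_multiaffine e a : F^`M(e).@[a] = F.@[shift a e] - F.@[a].
Proof.
rewrite /F mderiv_big !meval_big -sumrB; apply: eq_bigr => S _.
exact: mderiv_sqfree_shift.
Qed.

Lemma mderiv2_multiaffine e f a :
  F^`M(e)^`M(f).@[a] = F.@[shift (shift a f) e] - F.@[shift a f]
    - (F.@[shift a e] - F.@[a]).
Proof.
rewrite -!mderiv_multiaffine /F !mderiv_big !meval_big -sumrB; apply: eq_bigr => S _.
rewrite mderiv_sqfree; case: ifP => _; first exact: mderiv_sqfree_shift.
by rewrite mderiv0 !meval0 subr0.
Qed.

Lemma dhomog_multiaffine r : (forall S, P S -> #|S| = r) -> F \is r.-homog.
Proof.
move=> Pr; apply: rpred_sum => S PS; rewrite -(Pr S PS) /sqfree.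
rewrite -big_enum -sum1_card -big_enum /=.
elim: (enum _) => [|i s IH]; first by rewrite !big_nil dhomog1.
by rewrite !big_cons; apply: dhomogM => //; rewrite dhomogX; apply/eqP; exact: mdeg1.
Qed.

End MultiAffine.
(** * Incidence matrices and the matrix-tree theorem *)
Section Ends.
Variables (n : nat) (G : sgraph n).
Implicit Types (e : 'I_n) (S : {set 'I_n}) (x y : G).

(** The orientation of an edge is arbitrary: its two ends in the order of the
    enumeration of the edge. *)
Definition ehead e : G := enum_val (cast_ord (esym (edge_card G e)) ord0).
Definition etail e : G := enum_val (cast_ord (esym (edge_card G e)) ord_max).

Lemma ehead_neq_etail e : ehead e != etail e.
Proof. by apply/eqP => /enum_val_inj /cast_ord_inj. Qed.

Lemma edge_ends e : edge G e = [set ehead e; etail e].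
Proof.
apply/eqP; rewrite eq_sym eqEcard (edge_card G e) cards2 ehead_neq_etail andbT.
by rewrite finset.subUset !finset.sub1set !enum_valP.
Qed.

Lemma adj_sym S : ssrbool.symmetric (adj (G:=G) S).
Proof. by move=> x y; apply: eq_existsb => e; rewrite [[set x; y]%SET]finset.setUC. Qed.

Lemma connect_adj_sym S : connect_sym (adj (G:=G) S).
Proof. exact: sym_connect_sym (adj_sym S). Qed.

Lemma adj_irr S x : adj S x x = false.
Proof.
apply/negbTE/existsP => -[e /andP[_ /eqP E]].
by have := edge_card G e; rewrite E finset.setUid cards1.
Qed.

Lemma adj_ends S e : e \in S -> adj S (ehead e) (etail e).
Proof. by move=> eS; apply/existsP; exists e; rewrite eS edge_ends /=. Qed.

Lemma adj_cases S x y : adj S x y ->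
  exists2 e, e \in S &
    (ehead e = x /\ etail e = y) \/ (ehead e = y /\ etail e = x).
Proof.
case/existsP => e /andP[eS /eqP E]; exists e => //.
move: (ehead_neq_etail e) (set21 (ehead e) (etail e)) (set22 (ehead e) (etail e)).
rewrite -edge_ends E !inE => ht /orP[] /eqP h /orP[] /eqP t.
- by rewrite h t eqxx in ht.
- by left.
- by right.
- by rewrite h t eqxx in ht.
Qed.

Lemma adj_sub S1 S2 : S1 \subset S2 -> subrel (adj (G:=G) S1) (adj S2).
Proof.
move=> /fintype.subsetP sS x y /existsP[e /andP[eS E]]; apply/existsP; exists e.
by rewrite sS.
Qed.

End Ends.
Arguments ehead {n G} e.
Arguments etail {n G} e.

Section Incidence.
Variables (n : nat) (G : sgraph n) (r : nat).
Variables (vtx : 'I_r.+1 -> G) (vtx_bij : bijective vtx).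
Implicit Types (e : 'I_n) (S : {set 'I_n}).

Section Ring.
Variable T : comNzRingType.

(** The vertex [vtx ord0] is the root; its coordinate is deleted, so that its own
    column is zero. *)
Definition basis_col (x : G) : 'cV[T]_r := \col_i (vtx (lift ord0 i) == x)%:R.

Definition incidence : 'M[T]_(r, n) :=
  \matrix_(i, e) (basis_col (ehead e) i 0 - basis_col (etail e) i 0).

Definition supported m S (Z : 'M[T]_(n, m)) := forall e, e \notin S -> row e Z = 0.

Lemma incidence_delta e :
  incidence *m delta_mx e (0 : 'I_1) = basis_col (ehead e) - basis_col (etail e).
Proof. by rewrite -colE; apply/matrixP => i j; rewrite !mxE. Qed.

(** A path from x to y carries a unit flow: the signed sum of its edges has boundary
    y - x. Its coefficients are
    integers, so it exists over any ring; this integrality is what makes the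
    determinant of a spanning tree a unit. *)
Lemma connect_flow S x y : connect (adj S) x y ->
  exists2 z : 'cV[T]_n, supported S z & incidence *m z = basis_col y - basis_col x.
Proof.
case/connectP => p; elim: p x => [|x1 p IH] x /=.
  by move=> _ ->; exists 0; [move=> e _; rewrite row0 | rewrite mulmx0 subrr].
case/andP => /adj_cases [e eS xx1] /IH{}IH /IH[z Sz Bz].
have sD f : f \notin S -> row f (delta_mx e 0 : 'cV[T]_n) = 0.
  move=> fS; apply/matrixP => i j; rewrite !mxE.
  by case: eqP eS fS => // -> ->.
case: xx1 => [[hx tx]|[hx tx]].
- exists (z - delta_mx e 0); first by move=> f fS; rewrite raddfB /= Sz // sD // subrr.
  by rewrite mulmxBr Bz incidence_delta hx tx opprB addrA subrK.
- exists (z + delta_mx e 0); first by move=> f fS; rewrite raddfD /= Sz // sD // addr0.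
  by rewrite mulmxDr Bz incidence_delta hx tx addrA subrK.
Qed.

Lemma basis_col_root : basis_col (vtx ord0) = 0.
Proof.
apply/matrixP => i j; rewrite !mxE (bij_eq vtx_bij).
by rewrite eq_sym (negbTE (neq_lift _ _)).
Qed.

Lemma basis_col_lift i : basis_col (vtx (lift ord0 i)) = delta_mx i 0.
Proof.
apply/matrixP => k j; rewrite !mxE (bij_eq vtx_bij) (inj_eq lift_inj).
by rewrite ord1 eqxx andbT.
Qed.

Lemma connected_right_inverse S : connected_edges G S ->
  exists2 Z : 'M[T]_(n, r), supported S Z & incidence *m Z = 1%:M.
Proof.
move=> con.
have /fin_all_exists[z Hz] (i : 'I_r) : exists z : 'cV[T]_n, supported S z /\
    incidence *m z = basis_col (vtx (lift ord0 i)).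
  have [z Sz Bz] := connect_flow (con (vtx ord0) (vtx (lift ord0 i))).
  by exists z; split=> //; rewrite Bz basis_col_root subr0.
exists (\matrix_(e, i) z i e 0) => [e eS|].
  apply/matrixP => k i; have [/(_ e eS) /matrixP /(_ 0 0)] := Hz i.
  by rewrite !mxE.
apply/matrixP => i j; have [_ /matrixP /(_ i 0)] := Hz j.
rewrite basis_col_lift !mxE eqxx andbT => <-.
by apply: eq_bigr => e _; congr (_ * _); rewrite mxE.
Qed.

(** Row vectors are potentials vanishing at the root, and adding a constant to a
    potential does not change its differences along edges. *)
Lemma coboundary (chi : G -> T) : exists u : 'rV[T]_r,
  (forall i, u 0 i = chi (vtx (lift ord0 i)) - chi (vtx ord0)) /\
  forall e, (u *m incidence) 0 e = chi (ehead e) - chi (etail e).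
Proof.
pose u : 'rV[T]_r := \row_i (chi (vtx (lift ord0 i)) - chi (vtx ord0)).
exists u; split=> [i|e]; first by rewrite mxE.
have ub x : (u *m basis_col x) 0 0 = chi x - chi (vtx ord0).
  have [g gK Kg] := vtx_bij; rewrite -(Kg x).
  case: (unliftP ord0 (g x)) => [i|] ->.
    by rewrite basis_col_lift -colE !mxE.
  by rewrite basis_col_root mulmx0 mxE subrr.
have -> : (u *m incidence) 0 e = (u *m (incidence *m delta_mx e (0:'I_1))) 0 0.
  by rewrite mulmxA -colE [RHS]mxE.
rewrite incidence_delta mulmxBr mxE [X in _ + X]mxE !ub; ring.
Qed.

(** The potential is the indicator function of a connected component. *)
Lemma disconnected_potential S : ~ connected_edges G S ->
  exists2 u : 'rV[T]_r, u != 0 & forall e, e \in S -> (u *m incidence) 0 e = 0.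
Proof.
rewrite /connected_edges -existsNE => -[x]; rewrite -existsNE => -[y /negP xy].
have [u [u_val uB]] := coboundary (fun z => (connect (adj S) x z)%:R).
exists u => [|e eS].
  apply/eqP => u0; have H z : (connect (adj S) x z)%:R = (connect (adj S) x (vtx ord0))%:R :> T.
    have [g gK Kg] := vtx_bij; rewrite -(Kg z); case: (unliftP ord0 (g z)) => [i|] -> //.
    by apply/eqP; rewrite -subr_eq0 -u_val u0 mxE.
  have := H x; rewrite -(H y) connect0 (negbTE xy) => /eqP.
  by rewrite oner_eq0.
rewrite uB; apply/eqP; rewrite subr_eq0; apply/eqP; congr (nat_of_bool _)%:R.
apply/idP/idP => /connect_trans; apply; apply: connect1; rewrite ?adj_ends //.
by rewrite adj_sym adj_ends.
Qed.

Lemma mulmx_supported m S (M : 'M[T]_(r, n)) (Z : 'M[T]_(n, m)) k (f : 'I_k -> 'I_n) :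
  injective f -> S = [set f i | i in 'I_k] -> supported S Z ->
  colsub f M *m rowsub f Z = M *m Z.
Proof.
move=> fI SE sZ; apply/matrixP => i j; rewrite !mxE.
rewrite [RHS](bigID (fun e => e \in S)) /= [X in _ + X]big1 ?addr0; last first.
  by move=> e /sZ /matrixP /(_ 0 j); rewrite !mxE => ->; rewrite mulr0.
rewrite SE big_imset /=; last by move=> ? ? _ _; apply: fI.
by apply: eq_bigr => l _; rewrite !mxE.
Qed.

End Ring.

Lemma set_enum_val S : S = [set enum_val i | i in 'I_#|S|].
Proof.
apply/setP => e; apply/idP/imsetP => [eS|[i _ ->]]; last exact: enum_valP.
by exists (enum_rank_in eS e); rewrite ?enum_rankK_in.
Qed.
(** The rows of a reduced incidence matrix restricted to a connected set of edges
    are independent, since that restriction has a right inverse. *)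
Lemma connected_card S : connected_edges G S -> (r <= #|S|)%N.
Proof.
move=> /(@connected_right_inverse rat)[Z SZ BZ].
have SE := set_enum_val S.
have := mulmx_supported (incidence rat) enum_val_inj SE SZ.
rewrite BZ => /(congr1 mxrank); rewrite mxrank1 => <-.
exact: leq_trans (mxrankM_maxl _ _) (rank_leq_col _).
Qed.

(** Removing an edge of a cycle would keep the graph connected with only r - 1
    edges, against [connected_card]. *)
Lemma connected_minimal_acyclic S :
  connected_edges G S -> #|S| = r -> acyclic_edges G S.
Proof.
move=> con cS [|x [|x1 [|x2 p]]] // _; apply/negP => /andP[].
rewrite /= rcons_path /=; set y := last x2 p => /and4P[xx1 x1x2 pth yx].
rewrite !inE !negb_or => /and3P[/and3P[nx1 nx2 xp] /andP[x12 x1p] _].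
have y_in : y \in x2 :: p by exact: mem_last.
have nyx1 : y != x1.
  by apply: contraTneq y_in => ->; rewrite inE negb_or x12.
have nyx : y != x by apply: contraTneq y_in => ->; rewrite inE negb_or nx2.
have /existsP[e /andP[eS /eqP eE]] := yx.
pose S' := S :\ e.
have keep u v : adj S u v -> ~~ [&& u \in [set x; y]%SET & v \in [set x; y]%SET] ->
    adj S' u v.
  case/existsP => f /andP[fS /eqP fE] uv; apply/existsP; exists f.
  rewrite fE eqxx andbT !inE fS andbT; apply: contraNneq uv => fe.
  have := eE; rewrite -fe fE [[set y; x]%SET]finset.setUC => <-.
  by rewrite !inE !eqxx orbT.
(* the rest of the cycle avoids x, hence the removed edge *)
have avoid w q : path (adj S) w q -> x \notin w :: q -> path (adj S') w q.
  elim: q w => //= z q IH w /andP[wz pq].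
  rewrite !inE !negb_or eq_sym => /and3P[wx xz xq].
  rewrite IH ?inE ?negb_or ?xz // andbT; apply: keep => //.
  rewrite !inE (negbTE wx) (eq_sym z) (negbTE xz) /=.
  apply/negP => /andP[/eqP wy /eqP zy].
  by rewrite wy zy adj_irr in wz.
have cyx : connect (adj S') y x.
  rewrite connect_adj_sym; apply/connectP; exists (x1 :: x2 :: p) => //=.
  rewrite keep //=; last by rewrite !inE (eq_sym x1) (negbTE nx1) (eq_sym x1) (negbTE nyx1) andbF.
  by rewrite -[_ && _]/(path (adj S') x1 (x2 :: p)) avoid /= ?x1x2 // !inE !negb_or nx1 nx2.
have /connected_card : connected_edges G S'.
  move=> u v; have := con u v; apply: connect_sub => {u v} u v uv.
  have [uv'|] := boolP (adj S' u v); first exact: connect1.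
  case/existsP: uv => f /andP[fS /eqP fE] /existsP nf.
  have fe : f = e.
    by apply: contrapT => /eqP fe; apply: nf; exists f; rewrite !inE fe fS fE eqxx.
  have : u \in edge G e by rewrite -fe fE set21.
  have : v \in edge G e by rewrite -fe fE set22.
  rewrite eE !inE => /orP[] /eqP -> /orP[] /eqP -> //.
  by rewrite connect_adj_sym.
by rewrite -cS (cardsD1 e S) eS add1n ltnn.
Qed.

(** With more than r edges there is a linear relation between their columns. An
    edge e of its support can be eliminated from a right inverse of the incidence
    matrix, so S without e is still connected; a simple path in it between the ends
    of e closes to a cycle through e. *)
Lemma spanning_tree_card S : spanning_tree G S -> #|S| = r.
Proof.
case=> con acy; apply/eqP; rewrite eqn_leq connected_card // andbT leqNgt.
apply/negP => rS.
have SE := set_enum_val S.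
pose B : 'M[rat]_(r, n) := incidence rat.
pose BS := colsub (enum_val : 'I_#|S| -> 'I_n) B.
have : (0 < \rank (kermx BS^T))%N.
  by rewrite mxrank_ker subn_gt0 (leq_ltn_trans (rank_leq_col _)).
rewrite lt0n mxrank_eq0 => /rowV0Pn[z0 /sub_kermxP z0K z0_n0].
pose z : 'cV[rat]_n := \col_e \sum_(i | enum_val i == e) z0 0 i.
have zE (i : 'I_#|S|) : z (enum_val i) 0 = z0 0 i.
  rewrite mxE (big_pred1 i) // => j; exact: (inj_eq enum_val_inj).
have Sz : supported S z.
  move=> e eS; apply/matrixP => i j; rewrite !mxE big1 // => k /eqP ke.
  by rewrite -ke enum_valP in eS.
have Bz : B *m z = 0.
  rewrite -(mulmx_supported B enum_val_inj SE Sz).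
  have -> : rowsub enum_val z = z0^T :> 'M_(#|S|, 1).
    by apply/matrixP => i j; rewrite mxE ord1 zE mxE.
  by apply: trmx_inj; rewrite trmx_mul trmxK z0K trmx0.
clearbody z.
have [i zi] : exists i, z0 0 i != 0 by apply/rV0Pn.
pose e : 'I_n := enum_val i; have eS : e \in S by exact: enum_valP.
have ze : z e 0 != 0 by rewrite zE.
have con' : connected_edges G (S :\ e).
  have [Z SZ BZ] := connected_right_inverse rat con.
  (* subtract the multiple of the relation z that kills the row of e *)
  pose Z' := Z - (z e 0)^-1 *: (z *m row e Z).
  have BZ' : B *m Z' = 1%:M.
    by rewrite mulmxBr BZ -scalemxAr mulmxA Bz mul0mx scaler0 subr0.
  have Z'0 : forall f, f \notin S :\ e -> row f Z' = 0.
    move=> f; rewrite !inE negb_and negbK => /orP[/eqP ->|fS].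
      apply/matrixP => k j; rewrite !mxE big_ord1 !mxE mulKf // subrr //.
    apply/matrixP => k j; rewrite !mxE big_ord1.
    have /matrixP/(_ 0 j) := SZ f fS; rewrite !mxE => ->.
    have /matrixP/(_ 0 0) := Sz f fS; rewrite !mxE => ->.
    by rewrite mul0r mulr0 subrr.
  apply: contrapT => /(@disconnected_potential rat)[u u0 uB].
  suff : u = 0 by apply/eqP.
  rewrite -[u]mulmx1 -BZ' mulmxA; apply/matrixP => k j; rewrite mxE [RHS]mxE.
  apply: big1 => f _; have [fS|/Z'0] := boolP (f \in S :\ e).
    by rewrite ord1 uB // mul0r.
  by move=> /matrixP/(_ 0 j); rewrite !mxE => ->; rewrite mulr0.
have /connectP[p0 pth0 lst0] := con' (ehead e) (etail e).
move: pth0 lst0; case/shortenP => p pth unq _ lst {p0}.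
have := acy (ehead e :: p).
have ht := ehead_neq_etail G e.
case: p pth unq lst => [|y [|y2 p]].
- by move=> _ _ /= tE; rewrite tE eqxx in ht.
- rewrite /= andbT => /existsP[f /andP[]]; rewrite !inE => /andP[fe _] /eqP fE _ yE _.
  move: fE; rewrite -yE -edge_ends => /edge_inj fE.
  by rewrite fE eqxx in fe.
- move=> pth unq lst /(_ isT) /negP; apply; rewrite /ucycleb unq andbT.
  rewrite (cycle_path (ehead e)) /= in pth *.
  have lE : last y2 p = etail e by rewrite lst.
  rewrite lE adj_sym adj_ends //=.
  have sub : subrel (adj (G:=G) (S :\ e)) (adj S) by apply: adj_sub; exact: subsetDl.
  by case/and3P: pth => /sub -> /sub -> /(sub_path sub) ->.
Qed.

Lemma spanning_treeE S : spanning_tree G S <-> connected_edges G S /\ #|S| = r.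
Proof.
split=> [tS|[con cS]]; first by split; [case: tS | exact: spanning_tree_card].
by split=> //; exact: connected_minimal_acyclic.
Qed.

(** For a tree the integral right inverse makes the determinant of the r x r
    incidence matrix equal to 1 or -1, and the Gram determinant is its square. For
    any other set of r edges, which is disconnected, a potential lies in the kernel. *)
Lemma det_gram_tree (T : numDomainType) S : #|S| = r ->
  \det (gram (incidence T) (fun e => (e \in S)%:R)) = `[< spanning_tree G S >]%:R.
Proof.
move=> cS; case: asboolP => [/spanning_treeE[con _]|].
  have [Z SZ BZ] := connected_right_inverse int con.
  have [f fI SE] : exists2 f : 'I_r -> 'I_n, injective f & S = [set f i | i in 'I_r].
    exists (fun i => enum_val (cast_ord (esym cS) i)).
      by move=> i j /enum_val_inj /cast_ord_inj.
    apply/setP => e; apply/idP/imsetP => [eS|[i _ ->]]; last exact: enum_valP.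
    by exists (cast_ord cS (enum_rank_in eS e)); rewrite ?cast_ordK ?enum_rankK_in.
  pose B := incidence int; pose d := \det (colsub f B).
  have dd : d * d = 1.
    have /(congr1 determinant) := mulmx_supported B fI SE SZ.
    rewrite det_mulmx BZ det1 -/d => /(congr1 absz).
    rewrite abszM absz1 => /eqP; rewrite muln_eq1 => /andP[/eqP d1 _].
    by rewrite -expr2 -real_normK ?num_real // -abszE d1.
  have -> : gram (incidence T) (fun e => (e \in S)%:R)
      = map_mx intr (colsub f B *m (colsub f B)^T).
    apply/matrixP => i j; rewrite gramE !mxE rmorph_sum /=.
    rewrite (bigID (fun e => e \in S)) /= [X in _ + X]big1 ?addr0; last first.
      by move=> e /negbTE ->; rewrite !mul0r.
    under eq_bigr => e eS do rewrite eS mul1r.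
    rewrite SE big_imset /=; last by move=> ? ? _ _; apply: fI.
    apply: eq_bigr => k _; rewrite !mxE.
    by rewrite rmorphM !rmorphB !rmorph_nat.
  by rewrite det_map_mx det_mulmx det_tr dd rmorph1.
move=> nt; have [u u0 uB] : exists2 u : 'rV[T]_r, u != 0
    & forall e, e \in S -> (u *m incidence T) 0 e = 0.
  by apply: disconnected_potential => con; apply: nt; apply/spanning_treeE.
apply/eqP/det0P; exists u => //; rewrite /gram !mulmxA.
suff -> : u *m incidence T *m diag_mx (\row_e (e \in S)%:R) = 0 by rewrite mul0mx.
apply/matrixP => i e; rewrite mul_mx_diag !mxE ord1.
have [eS|] := boolP (e \in S); last by rewrite mulr0.
by have := uB e eS; rewrite mxE => ->; rewrite mul0r.
Qed.

(** Spanning trees have r edges, so both sides are combinations of the same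
    monomials; the coefficients agree by [det_gram_tree]. *)
Theorem matrix_tree (R : realType) (a : 'I_n -> R) :
  (kirchhoff G R).@[a] = \det (gram (incidence R) a).
Proof.
rewrite det_gram [LHS](raddf_sum (meval a)) /= (eq_bigr _ (fun S _ => sqfree_eval S a)).
rewrite big_mkcond [RHS]big_mkcond /=; apply: eq_bigr => S _.
case: ifPn => [/asboolP tS|nt].
  have cS := spanning_tree_card tS.
  by rewrite cS eqxx det_gram_tree // asboolT // mul1r.
by case: eqP => // cS; rewrite det_gram_tree // (negbTE nt) mul0r.
Qed.

End Incidence.
(** * Rank updates and the transfer matrix *)
Section RankUpdate.
Variables (R : fieldType) (r n : nat) (B : 'M[R]_(r, n)).

(** The matrix B^T L^-1 B: its (e, f) entry is the potential drop along f caused by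
    a unit current entering at one end of e and leaving at the other,
    and its diagonal consists of the effective resistances. *)
Definition transfer a := B^T *m invmx (gram B a) *m B.

Lemma eq_gram a b : a =1 b -> gram B a = gram B b.
Proof. by move=> ab; apply/matrixP => i j; rewrite !gramE; apply: eq_bigr => e _; rewrite ab. Qed.

(** The sequence g lists, with repetitions, the edges whose weight is raised by 1;
    each contributes the rank-one matrix of its column. *)
Lemma gram_update a k (g : 'I_k -> 'I_n) :
  gram B (fun i => a i + \sum_l (i == g l)%:R) = gram B a + colsub g B *m (colsub g B)^T.
Proof.
apply/matrixP => i j; rewrite [RHS]mxE !gramE [X in _ = _ + X]mxE.
under eq_bigr do rewrite !mulrDl; rewrite big_split /=; congr (_ + _).
under eq_bigr do rewrite !mulr_suml; rewrite exchange_big /=.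
apply: eq_bigr => l _; rewrite (bigD1 (g l)) //= eqxx mul1r big1 ?addr0 ?mxE //.
by move=> e /negbTE ->; rewrite !mul0r.
Qed.

Lemma det_gram_update a k (g : 'I_k -> 'I_n) : gram B a \in unitmx ->
  \det (gram B (fun i => a i + \sum_l (i == g l)%:R))
    = \det (gram B a) * \det (1%:M + mxsub g g (transfer a)).
Proof.
move=> Lu; rewrite gram_update; set C := colsub g B.
have -> : gram B a + C *m C^T = gram B a *m (1%:M + (invmx (gram B a) *m C) *m C^T).
  by rewrite mulmxDr mulmx1 !mulmxA mulmxV // mul1mx.
rewrite det_mulmx det_1D_mulmx; congr (_ * \det (_ + _)).
apply/matrixP => i j; rewrite /transfer -!mulmxA !mxE; apply: eq_bigr => l _.
rewrite !mxE; congr (_ * _); apply: eq_bigr => m _; by rewrite !mxE.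
Qed.

Lemma tr_transfer a : (transfer a)^T = transfer a.
Proof. by rewrite /transfer !trmx_mul trmxK trmx_inv tr_gram mulmxA. Qed.

Lemma transferC a i j : transfer a i j = transfer a j i.
Proof. by rewrite -[in LHS]tr_transfer mxE. Qed.

Lemma det_gram_shift a e : gram B a \in unitmx ->
  \det (gram B (shift a e)) = \det (gram B a) * (1 + transfer a e e).
Proof.
move=> Lu; have := det_gram_update (fun _ : 'I_1 => e) Lu.
rewrite det_mx11; move: (transfer a) => Q; rewrite !mxE eqxx => <-; congr (\det _); apply: eq_gram => i.
by rewrite big_ord1.
Qed.

Lemma det_gram_shift2 a e f : gram B a \in unitmx ->
  \det (gram B (shift (shift a f) e)) = \det (gram B a) *
    ((1 + transfer a f f) * (1 + transfer a e e) - transfer a e f ^+ 2).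
Proof.
move=> Lu; pose g (k : 'I_2) := if k == 0 then f else e.
transitivity (\det (gram B (fun i => a i + \sum_l (i == g l)%:R))).
  congr (\det _); apply: eq_gram => i.
  by rewrite !big_ord_recl big_ord0 addr0 addrA.
rewrite det_gram_update // det_mx22; move: (transferC a f e).
move: (transfer a) => Q Qfe; rewrite !mxE /= !add0r.
by rewrite Qfe expr2.
Qed.

Lemma transfer_idem a : gram B a \in unitmx ->
  transfer a *m diag_mx (\row_i a i) *m transfer a = transfer a.
Proof.
move=> Lu.
transitivity (B^T *m invmx (gram B a) *m (gram B a *m invmx (gram B a)) *m B).
  by rewrite /transfer /gram !mulmxA.
by rewrite mulmxV // mulmx1.
Qed.

Lemma trace_transfer a : gram B a \in unitmx ->
  \tr (transfer a *m diag_mx (\row_i a i)) = r%:R.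
Proof.
move=> Lu; transitivity (\tr (invmx (gram B a) *m gram B a)).
  by rewrite /transfer /gram -!mulmxA mxtrace_mulC !mulmxA.
by rewrite mulVmx // mxtrace1.
Qed.

(** Multiplying by B D(a) on the left and by D(a) B^T on the right undoes the two
    factors L^-1 hidden in the transfer matrix. *)
Lemma transfer_sandwich a v : gram B a \in unitmx ->
  transfer a *m diag_mx (\row_i v i) *m transfer a = 0 -> gram B v = 0.
Proof.
move=> Lu E; pose L := gram B a.
have -> : gram B v = B *m diag_mx (\row_i a i) *m
    (transfer a *m diag_mx (\row_i v i) *m transfer a) *m
    (diag_mx (\row_i a i) *m B^T).
  transitivity ((L *m invmx L) *m gram B v *m (invmx L *m L)).
    by rewrite mulmxV // mulVmx // mul1mx mulmx1.
  by rewrite /L /transfer {1 3 5}/gram !mulmxA.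
by rewrite E mulmx0 mul0mx.
Qed.

End RankUpdate.

(** * Positivity of the Hadamard square *)
Section HadamardSquare.
Variables (R : realFieldType) (n : nat) (Q : 'M[R]_n) (a : 'I_n -> R).
Local Notation D v := (diag_mx (\row_i v i)).
Local Notation av := (\row_i a i).
Hypothesis Qsym : Q^T = Q.
Hypothesis Qidem : Q *m D a *m Q = Q.

Definition hadamard_sq : 'M[R]_n := \matrix_(i, j) Q i j ^+ 2.
Definition diagonal : 'rV[R]_n := \row_i Q i i.

Let QC i j : Q i j = Q j i.
Proof. by rewrite -{1}Qsym mxE. Qed.

Lemma row_hadamard_sq : av *m hadamard_sq = diagonal.
Proof.
apply/matrixP => i j; rewrite [RHS]mxE -[in RHS]Qidem !mxE.
by apply: eq_bigr => k _; rewrite mul_mx_diag !mxE (QC j k); ring.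
Qed.

Lemma diagonal_dot : (diagonal *m av^T) 0 0 = \tr (Q *m D a).
Proof.
by rewrite mxE; apply: eq_bigr => i _; rewrite mul_mx_diag !mxE.
Qed.

Lemma tr_hadamard_sq : hadamard_sq^T = hadamard_sq.
Proof. by apply/matrixP => i j; rewrite !mxE QC. Qed.

Lemma trace_diag_form (N : 'M[R]_n) (v : 'I_n -> R) : N^T = N ->
  \tr (N *m D v *m N *m D v) = \sum_i \sum_j v i * v j * N i j ^+ 2.
Proof.
move=> Ns; apply: eq_bigr => i _; rewrite mul_mx_diag mxE [X in X * _]mxE mulr_suml.
by apply: eq_bigr => j _; rewrite mul_mx_diag -{2}Ns !mxE; ring.
Qed.

Hypothesis a_ge0 : forall i, 0 <= a i.
Hypothesis Qinj : forall v, Q *m D v *m Q = 0 -> v =1 (fun=> 0).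

(** The relation Q D(a) Q = Q rewrites the form of K as the sum of the
    a_k a_l M_kl^2, where M = Q D(w) Q. If it vanishes, so does D(a) M D(a), and
    then M itself, because M = Q (D(a) M D(a)) Q. *)
Lemma hadamard_sq_gt0 (w : 'rV[R]_n) : w != 0 -> 0 < (w *m hadamard_sq *m w^T) 0 0.
Proof.
move=> w0; pose v i := w 0 i; pose M := Q *m D v *m Q.
have Ms : M^T = M by rewrite /M !trmx_mul tr_diag_mx Qsym mulmxA.
have E : (w *m hadamard_sq *m w^T) 0 0 = \sum_k \sum_l a k * a l * M k l ^+ 2.
  rewrite -trace_diag_form //.
  have -> : \tr (M *m D a *m M *m D a) = \tr (Q *m D v *m Q *m D v).
    have -> : M *m D a *m M *m D a = (Q *m D v *m (Q *m D a *m Q) *m D v) *m (Q *m D a).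
      by rewrite /M !mulmxA.
    by rewrite mxtrace_mulC Qidem !mulmxA Qidem.
  rewrite trace_diag_form // mxE exchange_big.
  apply: eq_bigr => j _; rewrite !mxE mulr_suml; apply: eq_bigr => i _.
  by rewrite !mxE /v; ring.
have term_ge0 k l : 0 <= a k * a l * M k l ^+ 2.
  by rewrite mulr_ge0 ?sqr_ge0 // mulr_ge0.
rewrite E lt_neqAle sumr_ge0 ?andbT; last by move=> k _; apply: sumr_ge0.
apply: contraNneq w0 => /esym sum0.
have DMD : D a *m M *m D a = 0.
  have entry (N : 'M[R]_n) k l : (D a *m N *m D a) k l = a k * N k l * a l.
    by rewrite mul_mx_diag mul_diag_mx !mxE.
  apply/matrixP => k l; rewrite entry [RHS]mxE; apply/eqP.
  have row0 : \sum_l a k * a l * M k l ^+ 2 = 0.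
    by apply: (psumr_eq0P _ sum0) => // i _; apply: sumr_ge0.
  have kl0 : a k * a l * M k l ^+ 2 = 0.
    by apply: (psumr_eq0P _ row0) => // i _; apply: term_ge0.
  rewrite -sqrf_eq0; apply/eqP.
  by transitivity (a k * a l * (a k * a l * M k l ^+ 2)); [ring | rewrite kl0 mulr0].
have M0 : M = 0.
  have <- : Q *m (D a *m M *m D a) *m Q = M.
    by rewrite /M !mulmxA Qidem -!mulmxA [Q *m (D a *m _)]mulmxA Qidem.
  by rewrite DMD mulmx0 mul0mx.
by apply/eqP/matrixP => i j; rewrite ord1 mxE; exact: Qinj M0 j.
Qed.

End HadamardSquare.

(** Regard K as an inner product: a K = g and g a^T = r say that g v^T is the inner
    product of a and v, and that r is the squared length of a. *)
Section RankOneShift.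
Variables (R : realFieldType) (n r : nat) (K : 'M[R]_n) (a g : 'rV[R]_n).
Hypothesis Ksym : K^T = K.
Hypothesis Kgt0 : forall w : 'rV[R]_n, w != 0 -> 0 < (w *m K *m w^T) 0 0.
Hypothesis aK : a *m K = g.
Hypothesis ga : (g *m a^T) 0 0 = r%:R.
Hypothesis r_gt0 : (0 < r)%N.

Let form_split (w : 'rV[R]_n) (c : R) :
  (w *m (K + c *: (g^T *m g)) *m w^T) 0 0 =
  (w *m K *m w^T) 0 0 + c * ((g *m w^T) 0 0) ^+ 2.
Proof.
have wg : (w *m g^T) 0 0 = (g *m w^T) 0 0 by rewrite -[w *m g^T]trmxK trmx_mul trmxK mxE.
have -> : w *m (K + c *: (g^T *m g)) *m w^T
    = w *m K *m w^T + c *: ((w *m g^T) *m (g *m w^T)).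
  by rewrite mulmxDr mulmxDl -scalemxAr -scalemxAl !mulmxA.
rewrite mxE; congr (_ + _); rewrite mxE; congr (_ * _).
by rewrite mxE big_ord1 wg expr2.
Qed.

(** The form of K is nonnegative at the component of w orthogonal to a. *)
Lemma cauchy_schwarz (w : 'rV[R]_n) :
  ((g *m w^T) 0 0) ^+ 2 <= r%:R * (w *m K *m w^T) 0 0.
Proof.
set x := (g *m w^T) 0 0; set N := (w *m K *m w^T) 0 0.
have r0 : (0 : R) < r%:R by rewrite ltr0n.
pose c := x / r%:R; pose y := w - c *: a.
have yy : (y *m K *m y^T) 0 0 = N - x ^+ 2 / r%:R.
  have Ka : K *m a^T = g^T by rewrite -aK trmx_mul Ksym.
  have wg : (w *m g^T) 0 0 = x by rewrite /x -[g *m w^T]trmxK trmx_mul trmxK [RHS]mxE.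
  have -> : (y *m K *m y^T) = w *m K *m w^T - c *: (w *m g^T)
     - c *: (g *m w^T) + c *: (c *: (g *m a^T)).
    have yT : y^T = w^T - c *: a^T by rewrite /y linearB linearZ.
    rewrite yT /y !mulmxBl !mulmxBr -!scalemxAl -!scalemxAr aK -[w *m K *m a^T]mulmxA Ka. 
    by rewrite opprD opprK addrA.
  have entry (A1 A2 A3 A4 : 'M[R]_1) :
      (A1 - c *: A2 - c *: A3 + c *: (c *: A4)) 0 0
      = A1 0 0 - c * A2 0 0 - c * A3 0 0 + c * (c * A4 0 0).
    by rewrite !mxE.
  rewrite entry -/N -/x wg ga /c; field; exact: lt0r_neq0.
have : 0 <= N - x ^+ 2 / r%:R.
  rewrite -yy; have [->|/Kgt0/ltW //] := eqVneq y 0.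
  by rewrite !mul0mx mxE.
by rewrite subr_ge0 ler_pdivrMr // mulrC.
Qed.

(** When g w^T is nonzero, s - 1 > - 1 / r and [cauchy_schwarz] give strictness;
    when it is zero, positive definiteness of K does. *)
Lemma quadform_rank_one_gt0 (s : R) (w : 'rV[R]_n) : (r%:R - 1) / r%:R < s -> w != 0 ->
  0 < (w *m (K + (s - 1) *: (g^T *m g)) *m w^T) 0 0.
Proof.
move=> hs w0; rewrite form_split.
have r0 : (0 : R) < r%:R by rewrite ltr0n.
have := cauchy_schwarz w; have := Kgt0 w0.
set N := (w *m K *m w^T) 0 0; set x := (g *m w^T) 0 0 => N0 CS.
have hs' : 0 < r%:R * s - r%:R + 1.
  by move: hs; rewrite ltr_pdivrMr // => hs; rewrite mulrC; lra.
rewrite -(pmulr_rgt0 _ r0).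
have [x0|x0] := eqVneq x 0; first by rewrite x0 expr0n /= mulr0 addr0 mulr_gt0.
have x2 : 0 < x ^+ 2 by rewrite exprn_even_gt0.
have := mulr_gt0 hs' x2; nra.
Qed.

End RankOneShift.
(** * Signs of the eigenvalues *)
Section Inertia.
Local Open Scope sesquilinear_scope.
Variables (R : rcfType) (n : nat) (A : 'M[R]_n) (g u : 'rV[R]_n).
Hypothesis Asym : A^T = A.
Hypothesis Aneg : forall v : 'rV[R]_n, v != 0 -> (v *m g^T) 0 0 = 0 ->
  (v *m A *m v^T) 0 0 < 0.
Hypothesis Apos : 0 < (u *m A *m u^T) 0 0.

Local Notation toC := (real_complex R).
Local Notation cx := (map_mx toC).
Local Notation P := (spectralmx (cx A)).
Local Notation sp := (spectral_diag (cx A)).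

Lemma real_complexR (x : R) : toC x \is Num.real.
Proof. by apply/complex_realP; exists x. Qed.

Lemma adjoint_map m k (M : 'M[R]_(m, k)) : (cx M) ^t* = cx M^T.
Proof. by apply/matrixP => i j; rewrite !mxE conj_Creal // real_complexR. Qed.

Lemma hermsymm_map : cx A \is hermsymmx.
Proof.
apply/is_hermitianmxP; rewrite expr0 scale1r.
by rewrite -[RHS]/((cx A) ^t*) adjoint_map Asym.
Qed.

Lemma spectral_map : (cx A) = P ^t* *m diag_mx sp *m P.
Proof.
rewrite -invmx_unitary ?spectral_unitarymx //.
exact/orthomx_spectralP/hermitian_normalmx/hermsymm_map.
Qed.

Definition eig i : R := complex.Re (sp 0 i).

Lemma eigE i : sp 0 i = toC (eig i).
Proof.
by rewrite RRe_real // (mxOverP (hermitian_spectral_diag_real hermsymm_map)).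
Qed.

Lemma char_poly_eig : char_poly A = \prod_i ('X - (eig i)%:P).
Proof.
apply: (map_poly_inj toC); rewrite map_char_poly rmorph_prod /=.
under [RHS]eq_bigr do rewrite rmorphB /= map_polyX map_polyC /= -eigE.
have Pu : P ^t* *m P = 1%:M.
  by rewrite -invmx_unitary ?spectral_unitarymx // mulVmx // spectral_unit.
transitivity (char_poly (diag_mx sp)); last first.
  rewrite char_poly_trig; last by apply/is_trig_mxP => i j ij; rewrite mxE -val_eqE ltn_eqF.
  by apply: eq_bigr => i _; rewrite mxE eqxx.
rewrite /char_poly /char_poly_mx.
pose Q := map_mx (polyC : R[i] -> _) P; pose Qs := map_mx (polyC : R[i] -> _) (P ^t*).
have QsQ : Qs *m Q = 1%:M by rewrite -map_mxM Pu map_mx1.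
have -> : 'X%:M - map_mx polyC (cx A) = Qs *m ('X%:M - map_mx polyC (diag_mx sp)) *m Q.
  rewrite mulmxBr mulmxBl {1}spectral_map !map_mxM; congr (_ - _).
  by rewrite mul_mx_scalar -scalemxAl QsQ scale_scalar_mx mulr1.
by rewrite !det_mulmx mulrAC -det_mulmx QsQ det1 mul1r.
Qed.

Lemma spectral_form (y : 'rV[R[i]]_n) :
  ((y *m P) *m (cx A) *m (y *m P) ^t*) 0 0 = \sum_i sp 0 i * `|y 0 i| ^+ 2.
Proof.
have Pu : P *m P ^t* = 1%:M by apply/unitarymxP/spectral_unitarymx.
have -> : (y *m P) ^t* = P ^t* *m y ^t* by rewrite trmx_mul map_mxM.
rewrite {2}spectral_map.
have -> : y *m P *m (P ^t* *m diag_mx sp *m P) *m (P ^t* *m y ^t*)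
   = y *m (P *m P ^t*) *m diag_mx sp *m (P *m P ^t*) *m y ^t*.
  by rewrite !mulmxA.
rewrite Pu !mulmx1 mul_mx_diag mxE; apply: eq_bigr => i _.
by rewrite !mxE normCK mulrAC mulrC.
Qed.

(** At w = x + i y the hermitian form of a real symmetric matrix is the sum of its
    values at x and at y, and g w^T = 0 means g x^T = g y^T = 0. *)
Lemma complex_form_lt0 (w : 'rV[R[i]]_n) : w != 0 -> (w *m (cx g)^T) 0 0 = 0 ->
  (w *m (cx A) *m w ^t*) 0 0 < 0.
Proof.
pose x := map_mx (@complex.Re R) w; pose y := map_mx (@complex.Im R) w.
have wE : w = cx x + 'i%C *: cx y.
  by apply/matrixP => i j; rewrite !mxE -complexE.
have wC : w ^t* = cx x^T - 'i%C *: cx y^T.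
  apply/matrixP => i j; rewrite !mxE; case: (w j i) => a b.
  by apply/eqP; rewrite eq_complex /=; apply/andP; split; apply/eqP; ring.
move=> w0 wg.
have formE : w *m cx A *m w ^t* = cx (x *m A *m x^T + y *m A *m y^T).
  have yAx : y *m A *m x^T = x *m A *m y^T.
    transitivity (y *m A *m x^T)^T; last by rewrite !trmx_mul trmxK Asym mulmxA.
    by apply/matrixP => i j; rewrite !ord1 [RHS]mxE.
  rewrite wC {1}wE !map_mxD !map_mxM /= mulmxDl mulmxDl !mulmxBr.
  rewrite -!scalemxAl -!scalemxAr -!map_mxM yAx scalerA -expr2 sqr_i scaleN1r opprK.
  by rewrite addrA subrK.
have [xg yg] : (x *m g^T) 0 0 = 0 /\ (y *m g^T) 0 0 = 0.
  move: wg; rewrite wE map_trmx mulmxDl -scalemxAl -!map_mxM !mxE.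
  by move/eqP; rewrite eq_complex /= !(mul0r, mul1r, add0r, addr0, subr0, oppr0) => /andP[/eqP -> /eqP ->].
have le0 (v : 'rV[R]_n) : (v *m g^T) 0 0 = 0 -> (v *m A *m v^T) 0 0 <= 0.
  by move=> vg; have [->|/Aneg/(_ vg)/ltW//] := eqVneq v 0; rewrite !mul0mx mxE.
rewrite formE mxE -(rmorph0 toC) ltcR mxE.
have [x0|x0] := eqVneq x 0;
  last by have := Aneg x0 xg; have := le0 _ yg; lra.
have y0 : y != 0.
  by apply: contraNneq w0 => y0; rewrite wE x0 y0 !map_mx0 scaler0 addr0.
by have := Aneg y0 yg; have := le0 _ xg; lra.
Qed.

Lemma eig_gt0_ex : exists i, 0 < eig i.
Proof.
apply: contrapT => /forallNP H.
pose y := cx u *m P ^t*.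
have uE : cx u = y *m P.
  rewrite /y -mulmxA -invmx_unitary ?spectral_unitarymx //.
  by rewrite mulVmx ?spectral_unit // mulmx1.
have : 0 < \sum_i sp 0 i * `|y 0 i| ^+ 2.
  rewrite -spectral_form -uE adjoint_map -!map_mxM mxE -(rmorph0 toC) ltcR.
  exact: Apos.
apply/negP; rewrite -real_leNgt //; last first.
  by apply: sum_real => i _; rewrite realM // ?eigE ?real_complexR // realX.
apply: sumr_le0 => i _; rewrite mulr_le0_ge0 ?exprn_ge0 // eigE.
by rewrite -(rmorph0 toC) lecR leNgt; apply/negP/H.
Qed.

(** Some nonzero combination of two eigenvectors is orthogonal to g; if both
    eigenvalues were nonnegative the form would be nonnegative there, against
    [complex_form_lt0]. *)
Lemma eig_ge0_uniq i j : 0 <= eig i -> 0 <= eig j -> i = j.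
Proof.
move=> li lj; apply/eqP; apply: contraT => ij.
pose p k := (row k P *m (cx g)^T) 0 0.
have [[al be] /= ab0 abp] : exists2 ab : R[i] * R[i], (ab.1 != 0) || (ab.2 != 0) &
    ab.1 * p i + ab.2 * p j = 0.
  have [pj0|pj0] := eqVneq (p j) 0.
    by exists (0, 1); rewrite /= ?oner_eq0 ?orbT // mul0r pj0 mulr0 addr0.
  by exists (p j, - p i); rewrite /= ?pj0 // mulNr mulrC subrr.
pose y : 'rV[R[i]]_n := al *: delta_mx 0 i + be *: delta_mx 0 j.
have yi : y 0 i = al by rewrite !mxE !eqxx (negbTE ij) mulr1 mulr0 addr0.
have yj : y 0 j = be by rewrite !mxE !eqxx eq_sym (negbTE ij) mulr1 mulr0 add0r.
have yk k : k != i -> k != j -> y 0 k = 0.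
  by move=> ki kj; rewrite !mxE (negbTE ki) (negbTE kj) !mulr0 addr0.
have w0 : y *m P != 0.
  apply: contraTneq ab0 => yP; have y0 : y = 0.
    by rewrite -[y](mulmxK (spectral_unit (cx A))) yP mul0mx.
  by rewrite -yi -yj y0 !mxE eqxx.
have wg : (y *m P *m (cx g)^T) 0 0 = 0.
  rewrite -abp /y mulmxDl mulmxDl -!scalemxAl -!rowE.
  by rewrite mxE [X in X + _]mxE [X in _ + X]mxE.
have := complex_form_lt0 w0 wg; rewrite spectral_form.
apply: contraTT => _; rewrite -real_leNgt //; last first.
  by apply: sum_real => k _; rewrite realM // ?eigE ?real_complexR // realX.
apply: sumr_ge0 => k _; rewrite eigE.
have [->|ki] := eqVneq k i; first by rewrite mulr_ge0 ?exprn_ge0 // ler0c.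
have [->|kj] := eqVneq k j; first by rewrite mulr_ge0 ?exprn_ge0 // ler0c.
by rewrite yk // normr0 expr0n mulr0.
Qed.

Lemma eigenvalue_signs : exists s : seq R,
  [/\ char_poly A = \prod_(x <- s) ('X - x%:P),
      count (fun x => x < 0) s = n.-1 & count (fun x => 0 < x) s = 1%N].
Proof.
have [i0 pos0] := eig_gt0_ex.
have pos i : (0 < eig i) = (i == i0).
  by apply/idP/eqP => [/ltW li|-> //]; apply: eig_ge0_uniq => //; apply: ltW.
have neg i : (eig i < 0) = (i != i0).
  apply/idP/idP => [|ii0]; first by apply: contraTneq => ->; rewrite -leNgt ltW.
  rewrite ltNge; apply: contra ii0 => li; apply/eqP.
  by apply: eig_ge0_uniq => //; apply: ltW.
have one : count (pred1 i0) (enum 'I_n) = 1%N.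
  by rewrite count_uniq_mem ?enum_uniq // mem_enum.
exists [seq eig i | i <- enum 'I_n]; split.
- by rewrite char_poly_eig big_map big_enum.
- rewrite count_map (eq_count (a2 := predC (pred1 i0))) //.
  have := count_predC (pred1 i0) (enum 'I_n).
  by rewrite one size_enum_ord add1n => /(congr1 predn).
- by rewrite count_map (eq_count (a2 := pred1 i0)).
Qed.

End Inertia.

(** The determinant is the product of the eigenvalues; the two counts add up to n,
    so none of them is zero and the sign only depends on the number of negative
    ones. *)
Lemma eigenvalues_det_sign (R : realFieldType) n (A : 'M[R]_n) (s : seq R) :
  (0 < n)%N ->
  char_poly A = \prod_(x <- s) ('X - x%:P) ->
  count (fun x => x < 0) s = n.-1 -> count (fun x => 0 < x) s = 1%N ->
  0 < (-1) ^+ n.-1 * \det A.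
Proof.
move=> n0 sA neg pos.
have sz : size s = n.
  by have := size_char_poly A; rewrite sA size_prod_XsubC => -[].
have detE : \det A = \prod_(x <- s) x.
  have := char_poly_det A; rewrite sA -horner_coef0 horner_prod.
  under eq_bigr do rewrite hornerXsubC sub0r -mulN1r.
  rewrite big_split /= big_const_seq count_predT sz iter_mulr_1.
  by move=> /(mulfI _) -> //; rewrite expf_neq0 // oppr_eq0 oner_eq0.
rewrite detE -neg.
have : 0 \notin s.
  apply: contraTN (eqxx n) => s0.
  have : (count (fun x : R => (x < 0)%R) s + count (fun x : R => (0 < x)%R) s < size s)%N.
    have le t : (count (fun x : R => (x < 0)%R) t + count (fun x : R => (0 < x)%R) t <= size t)%N.
      elim: t => //= x t IH; rewrite addnACA -[(size t).+1]add1n leq_add //.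
      by case: ltgtP.
    elim: s s0 {sA neg pos sz detE} => //= x s IH.
    rewrite inE addnACA; case: (ltgtP 0 x) => [x0|x0|x0] /=; last by move=> _; rewrite ltnS; exact: le.
    - by move=> /IH; rewrite add0n add1n ltnS.
    - by move=> /IH; rewrite addn0 add1n ltnS.
  by rewrite neg pos addn1 prednK // sz ltnn.
elim: s {sA neg pos sz detE} => [|x s IH] /=; first by rewrite big_nil mulr1.
rewrite inE negb_or big_cons => /andP[]; case: (ltgtP x 0) => //= x0 _ /IH s0.
- by rewrite add1n exprS mulrACA mulr_gt0 // mulN1r oppr_gt0.
- by rewrite add0n mulrCA mulr_gt0.
Qed.
(** * The Kirchhoff polynomial at a point of a tree cone *)
Section KirchhoffAtPoint.
Variables (R : realType) (n : nat) (G : sgraph n) (r : nat).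
Variables (vtx : 'I_r.+1 -> G) (vtx_bij : bijective vtx).
Local Notation F := (kirchhoff G R).
Local Notation B := (incidence vtx R).

(** Simplicity of the graph enters here. Pair B D(v) B^T with the potentials that
    are the indicator functions of the two ends of e: only an edge with the same
    two ends contributes, so the value is - v_e. *)
Lemma gram_incidence_inj (v : 'I_n -> R) : gram B v = 0 -> v =1 (fun=> 0).
Proof.
move=> gv e.
have [u1 [_ h1]] := coboundary vtx_bij (fun x : G => (x == ehead e)%:R : R).
have [u2 [_ h2]] := coboundary vtx_bij (fun x : G => (x == etail e)%:R : R).
have : (u1 *m gram B v *m u2^T) 0 0 = 0 by rewrite gv mulmx0 mul0mx mxE.
have -> : u1 *m gram B v *m u2^T = (u1 *m B) *m diag_mx (\row_i v i) *m (u2 *m B)^T.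
  by rewrite /gram trmx_mul !mulmxA.
rewrite mxE (bigD1 e) //= big1 ?addr0 => [|f fe].
  rewrite mul_mx_diag mxE [(u2 *m B)^T _ _]mxE h1 h2 [(\row_i v i) _ _]mxE !eqxx.
  rewrite eq_sym (negbTE (ehead_neq_etail G e)) !mulr1n !mulr0n; lra.
rewrite mul_mx_diag mxE [(u2 *m B)^T _ _]mxE h1 h2.
have off (x : G) : x \notin edge G f -> (ehead f == x)%:R - (etail f == x)%:R = 0 :> R.
  rewrite edge_ends !inE negb_or => /andP[hx tx].
  by rewrite eq_sym (negbTE hx) eq_sym (negbTE tx) subrr.
have [hf|/off ->] := boolP (ehead e \in edge G f); last by rewrite !mul0r.
have [tf|/off ->] := boolP (etail e \in edge G f); last by rewrite mulr0.
case/eqP: fe; apply: (@edge_inj _ G); apply/eqP.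
rewrite eq_sym eqEcard !edge_card leqnn andbT edge_ends.
by rewrite finset.subUset !finset.sub1set hf tf.
Qed.

Lemma kirchhoff_eval a : F.@[a] = \sum_(S | `[< spanning_tree G S >]) \prod_(i in S) a i.
Proof.
rewrite [LHS](raddf_sum (meval a)) /=; apply: eq_bigr => S _.
exact: sqfree_eval.
Qed.

Lemma kirchhoff_gt0 T a : spanning_tree G T -> tree_cone T a -> 0 < F.@[a].
Proof.
move=> tT [aT aN]; have a0 i : 0 <= a i.
  by have [/aT/ltW|/aN] := boolP (i \in T).
rewrite kirchhoff_eval (bigD1 T) ?asboolT //=.
by rewrite ltr_pwDl ?prodr_gt0 // sumr_ge0 // => S _; rewrite prodr_ge0.
Qed.

(** With all weights 1 the Laplacian of a connected graph is nonsingular, because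
    u L u^T is the sum of the squares of the entries of u B and B has a right
    inverse; so the sum over spanning trees is not empty. *)
Lemma spanning_tree_exists : connected_graph G -> exists T, spanning_tree G T.
Proof.
move=> con; apply: contrapT => /forallNP noT.
have : \det (gram B (fun=> 1)) == 0.
  rewrite -matrix_tree // kirchhoff_eval big1 // => S /asboolP tS.
  by case: (noT S).
case/det0P => u u0 uL.
have uB e : (u *m B) 0 e = 0.
  have : (u *m gram B (fun=> 1) *m u^T) 0 0 = 0 by rewrite uL mul0mx mxE.
  have -> : u *m gram B (fun=> 1) *m u^T = (u *m B) *m (u *m B)^T.
    rewrite /gram trmx_mul !mulmxA; congr (_ *m _ *m _).
    by apply/matrixP => i j; rewrite mul_mx_diag !mxE mulr1.
  rewrite mxE => sum0.
  have sq f : (u *m B) 0 f * (u *m B)^T f 0 = (u *m B) 0 f ^+ 2.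
    by rewrite [(u *m B)^T _ _]mxE expr2.
  have sq_ge0 f : true -> 0 <= (u *m B) 0 f * (u *m B)^T f 0.
    by rewrite sq sqr_ge0.
  by apply/eqP; rewrite -sqrf_eq0 -sq (psumr_eq0P sq_ge0 sum0).
have [Z _ BZ] := connected_right_inverse vtx_bij R con.
case/eqP: u0; rewrite -[u]mulmx1 -BZ mulmxA.
have -> : u *m B = 0 by apply/matrixP => i e; rewrite ord1 uB mxE.
by rewrite mul0mx.
Qed.

Section Point.
Variable a : 'I_n -> R.
Hypothesis a_ge0 : forall i, 0 <= a i.
Hypothesis F_gt0 : 0 < F.@[a].
Local Notation Q := (transfer B a).
Local Notation K := (hadamard_sq Q).
Local Notation g := (diagonal Q).
Local Notation av := (\row_i a i).

Let Lu : gram B a \in unitmx.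
Proof. by rewrite unitmxE unitfE -matrix_tree // gt_eqF. Qed.

Lemma gradient_eval e : F^`M(e).@[a] = F.@[a] * Q e e.
Proof.
rewrite mderiv_multiaffine -/(kirchhoff G R) !(matrix_tree vtx_bij).
by rewrite det_gram_shift //; ring.
Qed.

Lemma hessian_eval e f :
  F^`M(e)^`M(f).@[a] = F.@[a] * (Q e e * Q f f - Q e f ^+ 2).
Proof.
rewrite mderiv2_multiaffine -/(kirchhoff G R) !(matrix_tree vtx_bij).
by rewrite det_gram_shift2 // !det_gram_shift //; ring.
Qed.

Lemma hessian_mx_eval : evalmx a (hessian F) = F.@[a] *: (g^T *m g - K).
Proof.
apply/matrixP => e f; rewrite [LHS]mxE [in LHS]mxE hessian_eval.
move: Q => q; rewrite !mxE big_ord1 !mxE //.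
Qed.

Lemma hlc_mx_eval (s : R) :
  evalmx a (- (F *: hessian F) + s%:MP *: ((gradient F)^T *m gradient F))
  = F.@[a] ^+ 2 *: (K + (s - 1) *: (g^T *m g)).
Proof.
have -> : evalmx a (- (F *: hessian F) + s%:MP *: ((gradient F)^T *m gradient F))
    = - (F.@[a] *: evalmx a (hessian F))
      + s *: ((map_mx (meval a) (gradient F))^T *m map_mx (meval a) (gradient F)).
  by rewrite /evalmx map_mxD map_mxN !map_mxZ /= mevalC map_mxM map_trmx.
have -> : map_mx (meval a) (gradient F) = F.@[a] *: g.
  apply/matrixP => i e; rewrite [LHS]mxE [X in X.@[_] = _]mxE gradient_eval.
  by rewrite [RHS]mxE [g _ _]mxE.
have -> : (F.@[a] *: g)^T = F.@[a] *: g^T by rewrite linearZ.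
rewrite hessian_mx_eval -!scalemxAl -!scalemxAr.
move: (g^T *m g) K => M1 M2; apply/matrixP => i j; rewrite !mxE; ring.
Qed.

Lemma hadamard_transfer_gt0 (w : 'rV[R]_n) : w != 0 -> 0 < (w *m K *m w^T) 0 0.
Proof.
apply: (hadamard_sq_gt0 (tr_transfer _ _) (transfer_idem Lu) a_ge0).
by move=> v /(transfer_sandwich Lu)/gram_incidence_inj.
Qed.

Let Ksym := tr_hadamard_sq (tr_transfer B a).
Let aK := row_hadamard_sq (tr_transfer B a) (transfer_idem Lu).
Let ga : (g *m av^T) 0 0 = r%:R.
Proof. by rewrite diagonal_dot trace_transfer. Qed.

Lemma hlc_mx_posdef (s : R) : (0 < r)%N -> (r%:R - 1) / r%:R < s ->
  posdefmx (evalmx a (- (F *: hessian F) + s%:MP *: ((gradient F)^T *m gradient F))).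
Proof.
move=> r0 hs; rewrite hlc_mx_eval; split=> [|w w0].
  by rewrite linearZ /= linearD linearZ /= trmx_mul trmxK Ksym.
rewrite -scalemxAr -scalemxAl mxE mulr_gt0 ?exprn_gt0 //.
exact: (quadform_rank_one_gt0 Ksym hadamard_transfer_gt0 aK ga).
Qed.

(** Here H = F (g^T g - K) is negative definite on g v^T = 0 since K is positive
    definite, and at a it takes the value F (r^2 - r). *)
Lemma hessian_inertia : (1 < r)%N -> exists s : seq R,
  [/\ eigenvalues (evalmx a (hessian F)) s,
      count (fun x => x < 0) s = n.-1 & count (fun x => 0 < x) s = 1%N].
Proof.
move=> r1.
have formE (w : 'rV[R]_n) : (w *m evalmx a (hessian F) *m w^T) 0 0
    = F.@[a] * ((g *m w^T) 0 0 ^+ 2 - (w *m K *m w^T) 0 0).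
  rewrite hessian_mx_eval -scalemxAr -scalemxAl mulmxBr mulmxBl mxE; congr (_ * _).
  rewrite mxE [X in _ + X]mxE !mulmxA -(mulmxA (w *m g^T)) [X in X - _]mxE big_ord1.
  have -> : w *m g^T = (g *m w^T)^T by rewrite trmx_mul trmxK.
  by rewrite [(g *m w^T)^T _ _]mxE expr2.
apply: (@eigenvalue_signs _ _ _ g av).
- rewrite hessian_mx_eval linearZ /= linearB /= trmx_mul trmxK; congr (_ *: (_ - _)).
  exact: Ksym.
- move=> w w0 wg; rewrite formE.
  have -> : (g *m w^T) 0 0 = 0 by rewrite -[g *m w^T]trmxK trmx_mul trmxK mxE.
  by rewrite expr0n /= sub0r mulrN oppr_lt0 mulr_gt0 // hadamard_transfer_gt0.
- rewrite formE ga aK ga mulr_gt0 // subr_gt0 -subr_gt0 expr2.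
  by rewrite -{3}[r%:R]mulr1 -mulrBr mulr_gt0 ?ltr0n ?subr_gt0 ?ltr1n ?(ltnW r1).
Qed.

End Point.
End KirchhoffAtPoint.

Local Open Scope classical_set_scope.
Local Open Scope ring_scope.

Theorem theorem4p2 (R : realType) (n r : nat) (G : sgraph n)
    (hconn : connected_graph G)
    (hV : #|G| = r.+1) (hr : (3 <= r.+1)%N) (hn : (3 <= n)%N) :
  [/\ strictly_hlc_on r (kirchhoff G R) (@positive_orthant R n),
      forall a : 'I_n -> R, positive_orthant a ->
        let H := evalmx a (hessian (kirchhoff G R)) in
        [/\ H \in unitmx,
            exists s : seq R,
              [/\ eigenvalues H s,
                  count (fun x => x < 0) s = n.-1 &
                  count (fun x => 0 < x) s = 1%N] &
            0 < (-1) ^+ n.-1 * \det H] &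
      forall T : {set 'I_n}, spanning_tree G T ->
        @positive_orthant R n `<=` @tree_cone R n T /\
        strictly_hlc_on r (kirchhoff G R) (@tree_cone R n T)].
Proof.
pose vtx (i : 'I_r.+1) : G := enum_val (cast_ord (esym hV) i).
have vtx_bij : bijective vtx.
  exists (fun x => cast_ord hV (enum_rank x)) => [i|x].
    by rewrite /vtx enum_valK cast_ordKV.
  by rewrite /vtx cast_ordK enum_rankK.
have cone T a : positive_orthant a -> @tree_cone R n T a.
  by move=> a0; split=> i _; [exact: a0 | exact/ltW/a0].
have on_cone T : spanning_tree G T ->
    strictly_hlc_on r (kirchhoff G R) (@tree_cone R n T).
  move=> tT a aT; split.
    by apply: dhomog_multiaffine => S /asboolP; exact: (spanning_tree_card vtx_bij).
  move=> s hs; apply: (hlc_mx_posdef vtx_bij) => //.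
  - by move=> i; case: aT => aT aN; have [/aT/ltW|/aN] := boolP (i \in T).
  - exact: kirchhoff_gt0 tT aT.
  - exact: ltnW.
have [T0 tT0] := spanning_tree_exists R vtx_bij hconn.
split.
- by move=> a /(cone T0); exact: on_cone.
- move=> a a0 H.
  have [s [sH neg pos]] := hessian_inertia vtx_bij (fun i => ltW (a0 i))
    (kirchhoff_gt0 tT0 (cone T0 a a0)) hr.
  have dH := eigenvalues_det_sign (ltnW (ltnW hn)) sH neg pos.
  split=> //; last by exists s.
  rewrite unitmxE unitfE; apply: contraTneq dH => ->.
  by rewrite mulr0 ltxx.
- move=> T tT; split; [exact: cone | exact: on_cone].
Qed.
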